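(* Let $\mathcal{L}\subseteq\mathbf{Z}^n$ be a lattice. Then the vertex ideal $V_{\mathcal{L}}$ equals $\bigcap_{\omega} \mathrm{in}_\omega(I_{\mathcal{L}})$, where the intersection runs over all generic weight vectors $\omega$.
   Context: $S=k[x_1,\ldots,x_n]$, $k$ a field, $x^u=\prod_i x_i^{u_i}$. For $u\in\mathbf{N}^n$ the fiber is $P_u=\mathrm{conv}\{v\in\mathbf{N}^n: u-v\in\mathcal{L}\}$. The vertex ideal $V_{\mathcal{L}}$ is the monomial ideal of $S$ spanned by the monomials $x^v$ such that $v$ is not a vertex of $P_v$ (so $x^v\notin V_{\mathcal{L}}$ iff $v$ is a vertex of its fiber). The lattice ideal is $I_{\mathcal{L}}=\langle x^u-x^v : u,v\in\mathbf{N}^n,\ u-v\in\mathcal{L}\rangle$. For $\omega\in\mathbf{R}^n$ with $\omega\cdot u>0$ for every nonzero $u\in\mathbf{N}^n\cap\mathcal{L}$, $\mathrm{in}_\omega(I_{\mathcal{L}})$ is the ideal generated by $\mathrm{in}_\omega(f)$, $f\in I_{\mathcal{L}}$, where $\mathrm{in}_\omega(f)$ is the sum of the terms of $f$ of maximal $\omega$-weight. Such $\omega$ is called generic if $\mathrm{in}_\omega(I_{\mathcal{L}})$ is a monomial ideal. *)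

(* Defs.v *)
From HB Require Import structures.
From mathcomp Require Import all_boot all_order all_algebra.
From mathcomp Require Import boolp classical_sets reals convex.
From mathcomp Require Import mpoly.

Set Implicit Arguments.
Unset Strict Implicit.
Unset Printing Implicit Defensive.

Import Order.TTheory GRing.Theory Num.Theory.

Local Open Scope classical_set_scope.
Local Open Scope ring_scope.

(* Elements of N^n are the multi-exponents 'X_{1..n}; a lattice in Z^n is a
   subgroup of 'rV[int]_n. *)

Definition int_vec n (u : 'X_{1..n}) : 'rV[int]_n := \row_i (u i)%:Z.

Definition real_vec (R : realType) n (u : 'X_{1..n}) : 'rV[R]_n :=
  \row_i (u i)%:R.

Definition dot (R : realType) n (c x : 'rV[R]_n) : R :=
  \sum_(i < n) c 0 i * x 0 i.

Definition convex_hull (R : realType) n (A : set 'rV[R]_n) : set 'rV[R]_n :=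
  smallest (@convex_set R 'rV[R]_n) A.

Definition fiber (R : realType) n (L : zmodClosed 'rV[int]_n) (u : 'X_{1..n}) :
    set 'rV[R]_n :=
  convex_hull [set real_vec R v | v in [set v | int_vec u - int_vec v \in L]].

Arguments fiber R [n] L u.

(* A face of P is the set of points of P lying on a hyperplane
   c . x = b such that c . x >= b is valid on P; c = 0 gives P itself
   and the empty face. *)
Definition is_face (R : realType) n (P F : set 'rV[R]_n) : Prop :=
  exists (c : 'rV[R]_n) (b : R),
    (forall x, P x -> b <= dot c x) /\ F = [set x | P x /\ dot c x = b].

Definition is_vertex (R : realType) n (P : set 'rV[R]_n) (x : 'rV[R]_n) : Prop :=
  is_face P [set x].

Definition lin_span (k : fieldType) n (G : set {mpoly k[n]}) :
    set {mpoly k[n]} :=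
  [set f | exists s : seq (k * {mpoly k[n]}),
     (forall t, t \in s -> G t.2) /\ f = \sum_(t <- s) t.1 *: t.2].

Definition ideal_gen (k : fieldType) n (G : set {mpoly k[n]}) :
    set {mpoly k[n]} :=
  [set f | exists s : seq ({mpoly k[n]} * {mpoly k[n]}),
     (forall t, t \in s -> G t.2) /\ f = \sum_(t <- s) t.1 * t.2].

Definition monomial_ideal (k : fieldType) n (I : set {mpoly k[n]}) : Prop :=
  exists M : set 'X_{1..n}, I = ideal_gen [set 'X_[k, m] | m in M].

Definition vertex_ideal (R : realType) (k : fieldType) n
    (L : zmodClosed 'rV[int]_n) : set {mpoly k[n]} :=
  lin_span [set 'X_[k, v] | v in
    [set v | ~ is_vertex (fiber R L v) (real_vec R v)]].

Arguments vertex_ideal R k [n] L.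

Definition lattice_ideal (k : fieldType) n (L : zmodClosed 'rV[int]_n) :
    set {mpoly k[n]} :=
  ideal_gen [set f | exists u v : 'X_{1..n},
    int_vec u - int_vec v \in L /\ f = 'X_[k, u] - 'X_[k, v]].

Arguments lattice_ideal k [n] L.

Definition weight (R : realType) n (w : 'rV[R]_n) (m : 'X_{1..n}) : R :=
  dot w (real_vec R m).

Definition initial_form (R : realType) (k : fieldType) n (w : 'rV[R]_n)
    (f : {mpoly k[n]}) : {mpoly k[n]} :=
  \sum_(m <- msupp f | all (fun m' => weight w m' <= weight w m) (msupp f))
    f@_m *: 'X_[m].

Definition initial_ideal (R : realType) (k : fieldType) n (w : 'rV[R]_n)
    (I : set {mpoly k[n]}) : set {mpoly k[n]} :=
  ideal_gen [set initial_form w f | f in I].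

Definition admissible (R : realType) n (L : zmodClosed 'rV[int]_n)
    (w : 'rV[R]_n) : Prop :=
  forall u : 'X_{1..n}, u != 0%MM -> int_vec u \in L -> 0 < weight w u.

Definition generic (R : realType) (k : fieldType) n
    (L : zmodClosed 'rV[int]_n) (w : 'rV[R]_n) : Prop :=
  admissible L w /\ monomial_ideal (initial_ideal w (lattice_ideal k L)).

Arguments generic [R] k [n] L w.

(* Main.v *)
(* A monomial x^v lies outside V_L iff some weight vector w attains its minimum
   over the fiber of v strictly at v.  If w is generic and v is not the strict
   minimizer, some v' <> v in the fiber has w.v' <= w.v, and x^v occurs in the
   initial form of x^v - x^v'.  Conversely, the coefficients of an element of
   I_L sum to zero on each fiber, so a strict w-minimizer never occurs in
   in_w(I_L); it remains to perturb w to a generic vector keeping v the strict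
   minimizer.  The moment curve t |-> w + (t, ..., t^n) with small t > 0 does
   this: a vector vanishing on no nonzero integer vector is generic, and only
   countably many t are excluded. *)
Require Import Defs.
From HB Require Import structures.
From mathcomp Require Import all_boot all_order all_algebra.
From mathcomp Require Import boolp classical_sets reals convex.
From mathcomp Require Import mpoly.
From mathcomp Require cardinality lebesgue_measure.
From mathcomp Require Import interval_inference.
From mathcomp Require Import ring lra.

Set Implicit Arguments.
Unset Strict Implicit.
Unset Printing Implicit Defensive.

Import Order.TTheory GRing.Theory Num.Theory.

Local Open Scope classical_set_scope.
Local Open Scope ring_scope.

(** * Tools: roots of polynomials, Dickson's lemma, small constants *)

Lemma finite_roots (F : fieldType) (p : {poly F}) :
  p != 0 -> cardinality.finite_set [set x | root p x].
Proof.
elim: {p}(size p) {-2}p (leqnn (size p)) => [|m IH] p.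
  by rewrite leqn0 size_poly_eq0 => /eqP->; rewrite eqxx.
move=> sz p0; have [[a pa]|noroot] := pselect (exists a, root p a); last first.
  apply: (@cardinality.sub_finite_set _ _ set0) => // x px.
  by case: noroot; exists x.
have /factor_theorem [q pE] := pa.
have q0 : q != 0 by apply: contraNneq p0 => q0; rewrite pE q0 mul0r.
apply: (@cardinality.sub_finite_set _ _ ([set x | root q x] `|` [set a])).
  move=> x /=; rewrite pE rootM root_XsubC => /orP[qx|/eqP ->]; first by left.
  by right.
rewrite cardinality.finite_setU; split; last exact: cardinality.finite_set1.
apply: (IH _ _ q0).
by move: sz; rewrite pE size_Mmonic ?monicXsubC // size_XsubC addn2.
Qed.

(* Countably many finite root sets form a Lebesgue null set. *)
Lemma exists_common_nonroot (R : realType) (T : countType)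
    (p : T -> {poly R}) (d : R) :
  (forall i, p i != 0) -> 0 < d ->
  exists t, [/\ 0 < t, t < d & forall i, ~~ root (p i) t].
Proof.
move=> p0 d0; apply: contrapT => H.
have ctb : cardinality.countable [set` `]0, d[].
  apply: (@cardinality.sub_countable _ _ _
            (\bigcup_(i in [set: T]) [set x | root (p i) x])).
    apply: cardinality.subset_card_le => t /=.
    rewrite in_itv /= => /andP[t0 td].
    apply: contrapT => nt; apply: H; exists t; split => // i.
    by apply/negP => ri; apply: nt; exists i.
  apply: cardinality.bigcup_countable => // i _.
  exact/cardinality.finite_set_countable/finite_roots.
have := lebesgue_measure.countable_lebesgue_measure0 ctb.
rewrite lebesgue_measure.lebesgue_measure_itv /= constructive_ereal.lte_fin d0.
move=> [] /eqP; rewrite subr0 => /eqP dz.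
by rewrite dz ltxx in d0.
Qed.

(* Dickson's lemma; only the coordinates in [I] are compared, for the sake of
   the induction. *)
Lemma dickson_on n (I : seq 'I_n) (S : set 'X_{1..n}) :
  exists s : seq 'X_{1..n}, (forall m, m \in s -> S m) /\
    forall x, S x -> exists2 m, m \in s & forall i, i \in I -> (m i <= x i)%N.
Proof.
elim: I S => [|j I IH] S.
  have [[y Sy]|nS] := pselect (exists y, S y).
    exists [:: y]; split=> [m|x _]; first by rewrite inE => /eqP->.
    by exists y; rewrite ?mem_head.
  by exists [::]; split => // x Sx; case: nS; exists x.
have [s0 [s0S s0P]] := IH S.
(* Points with bounded [x j] are covered slice by slice: on a slice coordinate [j] is constant, so
   [IH] suffices. The remaining points have [x j] at least every [m j] with [m \in s0], and [s0]
   covers them. *)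
have low N : exists s : seq 'X_{1..n}, (forall m, m \in s -> S m) /\
    forall x, S x -> (x j < N)%N ->
      exists2 m, m \in s & forall i, i \in j :: I -> (m i <= x i)%N.
  elim: N => [|N [s [sS sP]]]; first by exists [::].
  have [s1 [s1S s1P]] := IH [set x | S x /\ x j = N].
  exists (s ++ s1); split=> [m|x Sx].
    by rewrite mem_cat => /orP[/sS|/s1S []].
  rewrite ltnS leq_eqVlt => /orP[/eqP xN|xN].
    have [//|m ms1 mx] := s1P x.
    exists m; first by rewrite mem_cat ms1 orbT.
    move=> i; rewrite inE => /orP[/eqP->|/mx//].
    by have [_ ->] := s1S _ ms1; rewrite xN.
  by have [m ms mx] := sP x Sx xN; exists m; rewrite // mem_cat ms.
have [s1 [s1S s1P]] := low (\max_(m <- s0) m j).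
exists (s0 ++ s1); split=> [m|x Sx]; first by rewrite mem_cat => /orP[/s0S|/s1S].
have [/(s1P x Sx)[m ms mx]|xM] := ltnP (x j) (\max_(m <- s0) m j).
  by exists m; rewrite // mem_cat ms orbT.
have [m ms mx] := s0P x Sx.
exists m; first by rewrite mem_cat ms.
move=> i; rewrite inE => /orP[/eqP->|/mx//].
exact: leq_trans (leq_bigmax_seq _ ms isT) xM.
Qed.

Lemma dickson n (S : set 'X_{1..n}) :
  exists s : seq 'X_{1..n}, (forall m, m \in s -> S m) /\
    forall x, S x -> exists2 m, m \in s & (m <= x)%MM.
Proof.
have [s [sS sP]] := dickson_on (enum 'I_n) S; exists s; split=> // x Sx.
have [m ms mx] := sP x Sx; exists m => //; apply/mnm_lepP => i.
by rewrite mx // mem_enum.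
Qed.

Lemma exists_small_multiple (R : realFieldType) (T : eqType) (s : seq T)
    (g : T -> R) (K : R) : 0 <= K -> (forall m, m \in s -> 0 < g m) ->
  exists d, [/\ 0 < d, d <= 1 & forall m, m \in s -> d * K < g m].
Proof.
move=> K0; elim: s => [|x s IH] gs; first by exists 1; split.
have [m ms|d [d0 d1 ds]] := IH; first by apply: gs; rewrite inE ms orbT.
have gx : 0 < g x by apply: gs; rewrite mem_head.
have K1 : 0 < K + 1 by rewrite ltr_wpDl.
(* The denominator [K + 1] is positive even for [K = 0], and [K < K + 1] makes the bound strict. *)
exists (Num.min d (g x / (K + 1))); split.
- by rewrite lt_min d0 divr_gt0.
- by rewrite ge_min d1.
move=> m; rewrite inE => /orP[/eqP->|/ds]; last first.
  by apply: le_lt_trans; rewrite ler_wpM2r // ge_min lexx.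
apply: (@le_lt_trans _ _ (g x / (K + 1) * K)).
  by rewrite ler_wpM2r // ge_min lexx orbT.
by rewrite mulrAC ltr_pdivrMr // ltr_pM2l // ltrDl.
Qed.

(** * Weights of exponents and strict minima over convex hulls *)

Section Weights.
Variables (R : realType) (n : nat).
Implicit Types (w c x : 'rV[R]_n) (m v : 'X_{1..n}).

Lemma weightD w m1 m2 : weight w (m1 + m2)%MM = weight w m1 + weight w m2.
Proof.
rewrite /weight /dot -big_split; apply: eq_bigr => i _.
by rewrite !mxE mnmDE natrD mulrDr.
Qed.

Lemma weight0 w : weight w 0%MM = 0.
Proof. by rewrite /weight /dot big1 // => i _; rewrite mxE mnm0E mulr0. Qed.

Lemma int_vecD m1 m2 : int_vec (m1 + m2)%MM = int_vec m1 + int_vec m2.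
Proof. by apply/rowP => i; rewrite !mxE mnmDE PoszD. Qed.

Lemma int_vec_inj : injective (@int_vec n).
Proof.
by move=> m1 m2 /rowP H; apply/mnmP => i; have := H i; rewrite !mxE => -[].
Qed.

Lemma real_vec_inj : injective (@real_vec R n).
Proof.
move=> m1 m2 /rowP H; apply/mnmP => i; have := H i; rewrite !mxE => /eqP.
by rewrite eqr_nat => /eqP.
Qed.

Lemma weightB w m1 m2 :
  weight w m1 - weight w m2 =
  dot w (map_mx intr (int_vec m1 - int_vec m2)).
Proof.
rewrite /weight /dot -sumrB; apply: eq_bigr => i _.
by rewrite !mxE -mulrBr rmorphB.
Qed.

(** The point [x] together with the open half-space above it is a convex set containing [A], so it
    contains the hull. *)
Lemma convex_hull_strict_min (A : set 'rV[R]_n) w x :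
  (forall y, A y -> y <> x -> dot w x < dot w y) ->
  forall y, convex_hull A y -> y = x \/ dot w x < dot w y.
Proof.
move=> Ax; apply: smallest_sub => [|y Ay]; last first.
  by have [->|yx] := pselect (y = x); [left|right; apply: Ax].
(* The bounds [0 < t < 1] are strict, so one endpoint in the open half-space puts the combination
   there. *)
apply/convex_setW => y z; rewrite !inE => Hy Hz t t0 t1.
set a := t%:num in t0 t1.
have -> : convex.conv t y z = a *: (y : 'rV[R]_n) + (1 - a) *: (z : 'rV[R]_n).
  by [].
have dE (u1 u2 : 'rV[R]_n) :
    dot w (a *: u1 + (1 - a) *: u2) = a * dot w u1 + (1 - a) * dot w u2.
  rewrite /dot !mulr_sumr -big_split; apply: eq_bigr => i _ /=.
  by rewrite !mxE; ring.
rewrite inE dE; have [->|{}Hy] := Hy; have [->|{}Hz] := Hz.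
- by left; rewrite -scalerDl addrC subrK scale1r.
- by right; nra.
- by right; nra.
- by right; nra.
Qed.

End Weights.

(** * Vertices of fibers and perturbation of weights *)

Section Lattice.
Variables (R : realType) (n : nat) (L : zmodClosed 'rV[int]_n).
Implicit Types (w c : 'rV[R]_n) (v : 'X_{1..n}).

Definition strict_min w v := forall v', v' <> v ->
  int_vec v - int_vec v' \in L -> weight w v < weight w v'.

(** The normal of the face serves as weight: another lattice point attaining the minimum would lie
    in the face. Conversely, strict minimality on lattice points passes to their hull. *)
Lemma vertexP v :
  is_vertex (fiber R L v) (real_vec R v) <-> exists w, strict_min w v.
Proof.
split=> [[c [b [cb /seteqP[vF Fv]]]]|[w wv]].
  have [_ bE] := vF _ erefl; exists c => v' v'v v'L.
  have Pv' : fiber R L v (real_vec R v') by apply: sub_gen_smallest; exists v'.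
  rewrite /weight bE lt_neqAle (cb _ Pv') andbT; apply/eqP => bE'.
  by apply/v'v/(@real_vec_inj R); apply: Fv; split.
have Pv : fiber R L v (real_vec R v).
  by apply: sub_gen_smallest; exists v; rewrite //= subrr rpred0.
have hull : forall y, fiber R L v y ->
    y = real_vec R v \/ dot w (real_vec R v) < dot w y.
  apply: convex_hull_strict_min => y [v' /= v'L <-] ne.
  by apply: wv => // v'v; apply: ne; rewrite v'v.
exists w, (dot w (real_vec R v)); split=> [y /hull[->//|/ltW //]|].
apply/seteqP; split=> [y ->|y [/hull[//|ylt] yE]]; first by split.
by rewrite yE ltxx in ylt.
Qed.

(** The exponents start at 1, so the shift vanishes as [t] tends to 0 and does not touch the
    constant term of [moment_poly]. *)
Definition moment_shift c (t : R) : 'rV[R]_n := \row_i (c 0 i + t ^+ i.+1).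

(** For [0 < t <= 1] each power [t ^+ i.+1] lies between 0 and [t]. *)
Lemma moment_shift_weight c t v : 0 < t -> t <= 1 ->
  weight c v <= weight (moment_shift c t) v <= weight c v + t * (mdeg v)%:R.
Proof.
move=> t0 t1.
have -> : weight (moment_shift c t) v =
    weight c v + \sum_(i < n) t ^+ i.+1 * (v i)%:R.
  rewrite /weight /dot -big_split; apply: eq_bigr => i _ /=.
  by rewrite !mxE mulrDl.
rewrite lerDl lerD2l mdegE natr_sum mulr_sumr; apply/andP; split.
  by apply: sumr_ge0 => i _; rewrite mulr_ge0 // exprn_ge0 // ltW.
apply: ler_sum => i _; rewrite ler_wpM2r // exprS ger_pMr //.
by rewrite exprn_ile1 // ltW.
Qed.

Definition moment_poly c (l : 'rV[int]_n) : {poly R} :=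
  (dot c (map_mx intr l))%:P + \sum_(i < n) (l 0 i)%:~R *: 'X^(i.+1).

Lemma horner_moment_poly c l t :
  (moment_poly c l).[t] = dot (moment_shift c t) (map_mx intr l).
Proof.
rewrite hornerD hornerC horner_sum /dot -big_split; apply: eq_bigr => i _ /=.
by rewrite !mxE hornerZ hornerXn mulrDl [t ^+ _ * _]mulrC.
Qed.

(** The entries of [l] are the coefficients in degrees 1 to [n]. *)
Lemma moment_poly_neq0 c l : l != 0 -> moment_poly c l != 0.
Proof.
apply: contraNneq => p0; apply/eqP/rowP => i; rewrite mxE.
have := congr1 (fun p : {poly R} => p`_i.+1) p0.
rewrite coef0 coefD coefC /= add0r coef_sum (bigD1 i) //= big1 => [|j ji].
  by rewrite addr0 coefZ coefXn eqxx mulr1 => /eqP; rewrite intr_eq0 => /eqP.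
by rewrite coefZ coefXn eqSS eq_sym (inj_eq val_inj) (negPf ji) mulr0.
Qed.

(* By Dickson's lemma, strict minimality at [v] amounts to finitely many strict
   inequalities, up to adding nonnegative elements of [L], on which the
   perturbation [(t, t^2, ..., t^n)] is nonnegative. *)
Lemma strict_min_perturb c v : strict_min c v ->
  exists w, [/\ strict_min w v, admissible L w &
    forall l : 'rV[int]_n, l != 0 -> dot w (map_mx intr l) != 0].
Proof.
move=> cv.
(* [v + u] lies in the fiber of [v], so it weighs more than [v]. *)
have cpos u : u != 0%MM -> int_vec u \in L -> 0 < weight c u.
  move=> u0 uL; rewrite -(ltrDl (weight c v)) -weightD; apply: cv.
    move=> /eqP; rewrite -{2}[v]addm0 eqm_add2l => /eqP uE.
    by rewrite uE eqxx in u0.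
  by rewrite int_vecD opprD addrA subrr sub0r rpredN.
have [s [sS sP]] := dickson [set v' | v' <> v /\ int_vec v - int_vec v' \in L].
(* The shift raises the weight of [v] by at most [t] times [mdeg v]; for [t < d] this stays below
   every gap between [v] and [s]. *)
have [||d [d0 d1 ds]] := @exists_small_multiple R _ s
    (fun m => weight c m - weight c v) (mdeg v)%:R.
- by rewrite ler0n.
- by move=> m /sS [mv mL]; rewrite subr_gt0; apply: cv.
have [|t [t0 td tn]] := @exists_common_nonroot R {l : 'rV[int]_n | l != 0}
    (fun l => moment_poly c (val l)) d _ d0.
  by case=> l l0; apply: moment_poly_neq0.
have t1 : t <= 1 by apply: ltW; apply: lt_le_trans d1.
have wge u := moment_shift_weight c u t0 t1.
have wpos u : u != 0%MM -> int_vec u \in L -> 0 < weight (moment_shift c t) u.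
  by move=> u0 /(cpos _ u0) /lt_le_trans; apply; case/andP: (wge u).
exists (moment_shift c t); split=> //; last first.
  by move=> l l0; have := tn (Sub l l0); rewrite /root horner_moment_poly.
move=> v' v'v v'L; have [//|m ms mv'] := sP v'.
have [_ mL] := sS _ ms.
have uE : (v' - m + m)%MM = v' by rewrite submK.
have uL : int_vec (v' - m)%MM \in L.
  have -> : int_vec (v' - m)%MM = int_vec v' - int_vec m.
    by rewrite -[in RHS]uE int_vecD addrK.
  by rewrite -(subrKA (int_vec v)) -opprB rpredD ?rpredN.
have u0 : 0 <= weight (moment_shift c t) (v' - m)%MM.
  by have [->|u0] := eqVneq (v' - m)%MM 0%MM; rewrite ?weight0 // ltW ?wpos.
rewrite -uE weightD.
(* The shift costs [v] less than its gap to [m] and cannot lower the weight of [m]. *)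
have /andP[_ Hv] := wge v; have /andP[Hm _] := wge m.
have := ds _ ms.
have : t * (mdeg v)%:R <= d * (mdeg v)%:R by rewrite ler_wpM2r // ltW.
lra.
Qed.

End Lattice.

(** * Generated ideals and supports *)

Section Ideals.
Variables (k : fieldType) (n : nat).
Implicit Types (G H : set {mpoly k[n]}) (f g : {mpoly k[n]}).

Lemma ideal_gen_gen G f : G f -> ideal_gen G f.
Proof.
move=> Gf; exists [:: (1, f)]; rewrite big_seq1 mul1r; split=> // t.
by rewrite inE => /eqP->.
Qed.

Lemma ideal_gen0 G : ideal_gen G 0.
Proof. by exists [::]; rewrite big_nil. Qed.

Lemma ideal_genD G f g : ideal_gen G f -> ideal_gen G g -> ideal_gen G (f + g).
Proof.
move=> [s [sG ->]] [s' [sG' ->]]; exists (s ++ s'); rewrite big_cat; split=> // t.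
by rewrite mem_cat => /orP[/sG|/sG'].
Qed.

Lemma ideal_genM G f g : ideal_gen G g -> ideal_gen G (f * g).
Proof.
move=> [s [sG ->]]; exists [seq (f * t.1, t.2) | t <- s]; split.
  by move=> t /mapP[t' /sG Gt' ->].
by rewrite big_map mulr_sumr; apply: eq_bigr => t _; rewrite mulrA.
Qed.

Lemma ideal_genZ G c g : ideal_gen G g -> ideal_gen G (c *: g).
Proof. by rewrite -mul_mpolyC; apply: ideal_genM. Qed.

Lemma ideal_gen_sum (T : eqType) (s : seq T) (F : T -> {mpoly k[n]}) G :
  (forall t, t \in s -> ideal_gen G (F t)) -> ideal_gen G (\sum_(t <- s) F t).
Proof.
rewrite big_seq => H; elim/big_ind: _ => [|f g|t /H//].
  exact: ideal_gen0.
exact: ideal_genD.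
Qed.

Lemma ideal_gen_sub G H : G `<=` ideal_gen H -> ideal_gen G `<=` ideal_gen H.
Proof.
move=> GH f [s [sG ->]]; apply: ideal_gen_sum => t /sG /GH.
exact: ideal_genM.
Qed.

Lemma msupp_sum_mem (T : eqType) (s : seq T) (F : T -> {mpoly k[n]}) v :
  v \in msupp (\sum_(t <- s) F t) -> exists2 t, t \in s & v \in msupp (F t).
Proof.
move=> vs; apply: contrapT => nt; move: vs; rewrite mcoeff_msupp raddf_sum.
rewrite big_seq big1 ?eqxx // => t ts; apply/eqP; rewrite mcoeff_eq0.
by apply/negP => vt; apply: nt; exists t.
Qed.

Lemma msupp_mul_mem f g v : v \in msupp (f * g) ->
  exists a b, [/\ a \in msupp f, b \in msupp g & v = (a + b)%MM].
Proof.
by move=> /msuppM_le /allpairsP[[a b] /= [af bg ->]]; exists a, b.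
Qed.

(** Every exponent surviving in a combination of generators already occurs in one product, so its
    monomial is a multiple of a generator. *)
Lemma monomial_ideal_msupp I f v :
  monomial_ideal I -> I f -> v \in msupp f -> I 'X_[v].
Proof.
move=> [M ->] [s [sM ->]] /msupp_sum_mem [t ts] /msupp_mul_mem [a [b [_ bt ->]]].
have [m Mm tE] := sM _ ts; move: bt; rewrite -tE => /mem_msuppXP <-.
by rewrite mpolyXD; apply/ideal_genM/ideal_gen_gen; exists m.
Qed.

End Ideals.

(** * Initial ideals of the lattice ideal *)

Section InitialIdeal.
Variables (R : realType) (k : fieldType) (n : nat) (L : zmodClosed 'rV[int]_n).
Implicit Types (w : 'rV[R]_n) (f : {mpoly k[n]}) (u v m : 'X_{1..n}).

Lemma mcoeff_initial_form w f m : (initial_form w f)@_m =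
  if all (fun m' => weight w m' <= weight w m) (msupp f) then f@_m else 0.
Proof.
rewrite /initial_form raddf_sum /= big_mkcond /=.
under eq_bigr => m' _ do rewrite mcoeffZ mcoeffX.
have other m' : m' != m ->
    (if all (fun m0 => weight w m0 <= weight w m') (msupp f)
     then f@_m' * (m' == m)%:R else 0) = 0.
  by move=> /negPf ->; rewrite mulr0 if_same.
have [mf|mf] := boolP (m \in msupp f).
  rewrite (bigD1_seq m) ?msupp_uniq //= big1 ?addr0; last by move=> i /other.
  by rewrite eqxx mulr1.
(* Off the support the value is 0 in both branches. *)
rewrite memN_msupp_eq0 // if_same big_seq big1 // => m' m'f; apply: other.
by apply: contraNneq mf => <-.
Qed.

Lemma mem_msupp_binomial u v m :
  m \in msupp ('X_[k, u] - 'X_[k, v]) -> m = u \/ m = v.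
Proof.
rewrite mcoeff_msupp mcoeffB !mcoeffX.
have [->|_] := eqVneq u m; first by left.
by have [->|_] := eqVneq v m; [right|rewrite subrr eqxx].
Qed.

(** In a tie the initial form is the whole binomial, hence membership in the support rather than an
    equality. *)
Lemma initial_form_binomial_mem w u v : v <> u -> weight w v <= weight w u ->
  u \in msupp (initial_form w ('X_[k, u] - 'X_[k, v])).
Proof.
move=> /eqP vu wvu; rewrite mcoeff_msupp mcoeff_initial_form ifT.
  by rewrite mcoeffB !mcoeffX eqxx (negPf vu) subr0 oner_eq0.
by apply/allP => m /mem_msupp_binomial [] ->.
Qed.

Lemma initial_form_binomial w u v : weight w v < weight w u ->
  initial_form w ('X_[k, u] - 'X_[k, v]) = 'X_[u].
Proof.
move=> wvu; have vu : v == u = false.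
  by apply: contraTF wvu => /eqP ->; rewrite ltxx.
have us : u \in msupp ('X_[k, u] - 'X_[k, v]).
  by rewrite mcoeff_msupp mcoeffB !mcoeffX eqxx vu subr0 oner_eq0.
apply/mpolyP => m; rewrite mcoeff_initial_form mcoeffB !mcoeffX.
have [<-|um] := eqVneq u m.
  rewrite vu subr0 ifT //.
  by apply/allP => m' /mem_msupp_binomial [] -> //; apply: ltW.
have [vm|_] := eqVneq v m; last by rewrite subrr if_same.
rewrite ifF //; apply/negbTE/negP => /allP /(_ u us).
by rewrite -vm leNgt wvu.
Qed.

Lemma lattice_ideal_binomial u v : int_vec u - int_vec v \in L ->
  lattice_ideal k L ('X_[u] - 'X_[v]).
Proof. by move=> uv; apply: ideal_gen_gen; exists u, v. Qed.

Lemma initial_ideal_binomial w u v :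
  int_vec u - int_vec v \in L -> weight w v < weight w u ->
  initial_ideal w (lattice_ideal k L) 'X_[u].
Proof.
move=> uv wvu; apply: ideal_gen_gen; exists ('X_[k, u] - 'X_[k, v]).
  exact: lattice_ideal_binomial.
exact: initial_form_binomial.
Qed.

(** Multiplying a binomial by a monomial keeps the difference of its exponents, so scalar
    coefficients suffice. *)
Lemma lattice_ideal_span f : lattice_ideal k L f ->
  exists s : seq (k * ('X_{1..n} * 'X_{1..n})),
    (forall t, t \in s -> int_vec t.2.1 - int_vec t.2.2 \in L) /\
    f = \sum_(t <- s) t.1 *: ('X_[t.2.1] - 'X_[t.2.2]).
Proof.
move=> [s [sG ->]]; elim: s sG => [|[p g] s IH] sG.
  by exists [::]; rewrite !big_nil.
have [|s' [sL' sE']] := IH; first by move=> t ts; apply: sG; rewrite inE ts orbT.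
have [u [v [uv gE]]] := sG (p, g) (mem_head _ _).
exists ([seq (p@_m, ((m + u)%MM, (m + v)%MM)) | m <- msupp p] ++ s'); split.
  move=> t; rewrite mem_cat => /orP[/mapP[m _ ->] /=|/sL'//].
  by rewrite !int_vecD opprD addrACA subrr add0r.
rewrite big_cons big_cat big_map -sE' /=; congr (_ + _).
rewrite /= in gE; rewrite gE {1}[p]mpolyE mulr_suml.
by apply: eq_bigr => m _; rewrite !mpolyXD -mulrBr scalerAl.
Qed.

(* The coefficients of an element of the lattice ideal sum to zero over each
   fiber, so its support meets every fiber in zero or at least two points. *)
Lemma lattice_ideal_msupp f v : lattice_ideal k L f -> v \in msupp f ->
  exists v', [/\ v' <> v, v' \in msupp f & int_vec v - int_vec v' \in L].
Proof.
move=> /lattice_ideal_span [s [sL fE]] vf; apply: contrapT => alone.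
(* [U] lists [v] and all exponents of the combination once each, which makes the sum over the fiber
   finite. *)
pose U := undup (v :: [seq t.2.1 | t <- s] ++ [seq t.2.2 | t <- s]).
pose cls m := int_vec v - int_vec m \in L.
have sumX a : a \in U -> \sum_(m <- U | cls m) ('X_[k, a])@_m = (cls a)%:R.
  move=> aU; rewrite big_mkcond (bigD1_seq a) ?undup_uniq //= big1 => [|m ma].
    by rewrite addr0 mcoeffX eqxx; case: (cls a).
  by rewrite mcoeffX eq_sym (negPf ma) if_same.
have sumf : \sum_(m <- U | cls m) f@_m = 0.
  rewrite fE; under eq_bigr => m _ do rewrite raddf_sum.
  rewrite exchange_big big_seq big1 //= => t ts.
  under eq_bigr => m _ do rewrite mcoeffZ mcoeffB.
  rewrite -mulr_sumr sumrB !sumX.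
  - suff -> : cls t.2.1 = cls t.2.2 by rewrite subrr mulr0.
    have tL := sL _ ts; rewrite /cls -[in LHS](rpredDr _ tL).
    by rewrite addrA subrK.
  - by rewrite mem_undup inE mem_cat (map_f (fun t => t.2.2) ts) !orbT.
  - by rewrite mem_undup inE mem_cat (map_f (fun t => t.2.1) ts) orbT.
have vU : v \in U by rewrite mem_undup mem_head.
suff fv : f@_v = 0 by move: vf; rewrite mcoeff_msupp fv eqxx.
(* By [alone], all terms of the fiber sum other than [f@_v] vanish. *)
rewrite -sumf big_mkcond (bigD1_seq v) ?undup_uniq //= big1 => [|m mv].
  by rewrite /cls subrr rpred0 addr0.
case: ifP => // mL; apply/eqP; rewrite mcoeff_eq0; apply/negP => mf.
by apply: alone; exists m; split=> //; apply/eqP.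
Qed.

(** Write [v = a + b] with [b] of top weight in some [g] of the lattice ideal. Another exponent [b']
    of [g] in the fiber of [b] weighs at most as much, so [a + b'] defeats [v]. *)
Lemma initial_ideal_msupp w f v :
  initial_ideal w (lattice_ideal k L) f -> v \in msupp f -> ~ strict_min L w v.
Proof.
move=> [s [sI ->]] /msupp_sum_mem [t ts] /msupp_mul_mem [a [b [_ bt ->]]] smin.
have [g Ig gE] := sI _ ts; move: bt; rewrite -gE mcoeff_msupp.
rewrite mcoeff_initial_form; case: ifP => [/allP wb|_]; last by rewrite eqxx.
rewrite -mcoeff_msupp => /(lattice_ideal_msupp Ig) [b' [bb' b'g bL]].
have ab : (a + b')%MM <> (a + b)%MM by move=> /addmI.
have := smin _ ab; rewrite !int_vecD opprD addrACA subrr add0r !weightD.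
by rewrite ltrD2l ltNge wb // => /(_ bL).
Qed.

(** Independence rules out ties. If ['X_[m]] is not in [I], binomials show that nothing in the fiber
    of [m] is lighter, so [m] is a strict minimizer and occurs in no element of [I]. *)
Lemma generic_independent w : admissible L w ->
  (forall l : 'rV[int]_n, l != 0 -> dot w (map_mx intr l) != 0) ->
  generic k L w.
Proof.
move=> adm indep; split=> //.
set I := initial_ideal w _.
exists [set m | I 'X_[m]]; apply/seteqP; split; last first.
  by apply: ideal_gen_sub => _ [m Im <-].
apply: ideal_gen_sub => f fI; have {}fI : I f by apply: ideal_gen_gen.
rewrite [f]mpolyE; apply: ideal_gen_sum => m mf.
apply/ideal_genZ/ideal_gen_gen; exists m => //=.
apply: contrapT => nI; apply: (initial_ideal_msupp fI mf) => v vm mvL.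
rewrite lt_neqAle -subr_eq0 weightB indep /=; last first.
  rewrite subr_eq0; apply/eqP => /int_vec_inj /esym //.
by rewrite leNgt; apply/negP => /(initial_ideal_binomial mvL).
Qed.

End InitialIdeal.

Theorem theorem2p3 (R : realType) (k : fieldType) (n : nat)
    (L : zmodClosed 'rV[int]_n) :
  vertex_ideal R k L =
  \bigcap_(w in [set w : 'rV[R]_n | generic k L w])
    initial_ideal w (lattice_ideal k L).
Proof.
apply/seteqP; split=> [_ [s [sV ->]] w [_ mono]|f fI].
  apply: ideal_gen_sum => t /sV [v nv <-]; apply: ideal_genZ.
  (* If ['X_[v]] were outside the initial ideal, [w] would be strictly minimal at [v], making [v] a
     vertex. *)
  apply: contrapT => nI; apply/nv/vertexP; exists w => v' v'v vL.
  rewrite ltNge; apply/negP => wv; apply: nI.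
  apply: (monomial_ideal_msupp mono _ (initial_form_binomial_mem k v'v wv)).
  apply: ideal_gen_gen; exists ('X_[k, v] - 'X_[k, v']) => //.
  exact: lattice_ideal_binomial.
(* [f] is the combination of its own monomials; a vertex [v] in its support would be a strict
   minimizer for some generic [w], whose initial ideal then excludes [f]. *)
exists [seq (f@_m, 'X_[m]) | m <- msupp f]; rewrite big_map -mpolyE; split=> //.
move=> _ /mapP[v vf ->] /=; exists v => //= /vertexP [c cv].
have [w [wv adm indep]] := strict_min_perturb cv.
exact: initial_ideal_msupp (fI w (generic_independent k adm indep)) vf wv.
Qed.
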